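(* Let $x>0$ and $\nu\ge \frac12$. Then $$x\frac{I_{\nu-1}(x)}{I_\nu(x)}>\nu-\frac12\left(1+\frac{\nu^2}{\nu^2+x^2}\right)+\sqrt{x^2+\left(\frac{\nu}{\sqrt{\nu^2+x^2}}+\sqrt{\nu^2-\frac{x^4}{4(x^2+\nu^2)^2}}\right)^2}$$ and $$x\frac{K_{\nu+1}(x)}{K_\nu(x)}<\nu+\frac12\left(1+\frac{\nu^2}{\nu^2+x^2}\right)+\sqrt{x^2+\left(-\frac{\nu}{\sqrt{\nu^2+x^2}}+\sqrt{\nu^2-\frac{x^4}{4(x^2+\nu^2)^2}}\right)^2}.$$
   Context: $I_\nu(x)$ and $K_\nu(x)$ denote the modified Bessel functions of the first and second kind, of real order $\nu$ and real argument $x>0$. *)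

(* Defs.v *)
From Stdlib Require Import Reals Factorial.
From Coquelicot Require Import Coquelicot.
Open Scope R_scope.

(** Reciprocal Gamma function, by Gauss's limit
    1 / Gamma(z) = lim_n z (z+1) ... (z+n) / (n! n^z),
    which converges for every real z (with value 0 at z = 0, -1, -2, ...). *)
Definition rGamma (z : R) : R :=
  real (Lim_seq (fun n : nat =>
    prod_f_R0 (fun k => z + INR k) n / (INR (fact n) * Rpower (INR n) z))).

(** I_nu(x) = sum_k (x/2)^(2k+nu) / (k! Gamma(nu+k+1)), for x > 0;
    [Rpower] is only meaningful for a positive base. *)
Definition BesselI (nu x : R) : R :=
  Series (fun k : nat =>
    Rpower (x / 2) (2 * INR k + nu) * rGamma (nu + INR k + 1) / INR (fact k)).

(** K_nu(x) = int_0^oo exp(-x cosh t) cosh(nu t) dt, for x > 0 and every real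
    order nu (integer orders included, where Macdonald's formula
    pi/2 (I_{-nu} - I_nu) / sin(nu pi) has to be read as a limit). *)
Definition BesselK (nu x : R) : R :=
  RInt_gen (fun t => exp (- x * cosh t) * cosh (nu * t))
           (at_point 0) (Rbar_locally p_infty).

(* Main.v *)
(** Both y = x I_nu' / I_nu = x I_{nu-1} / I_nu - nu and
    y = x K_nu' / K_nu = nu - x K_{nu+1} / K_nu solve the Riccati equation
    x y' = x^2 + nu^2 - y^2, and both inequalities read y > B, where, with sg = 1 for
    I_nu and sg = -1 for K_nu,
      q = nu^2 / (nu^2 + x^2),  p = 1 - q,  r = sqrt q,  T = sqrt (nu^2 - p^2 / 4),
      W = sg r + T,  S = sqrt (x^2 + W^2),  B = - (1 + q) / 2 + sg S.
    The bound satisfies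
      sg S (x^2 + nu^2 - B^2 - x B') = D^2 + sg p r D + p^2 q W / (2 T),  D = W - r S.
    The right-hand side is positive: for sg = 1 because W > T, and for sg = -1 because
    D < 0 if W >= 0, while D^2 >= p nu^2 dominates if W < 0.

    So for I_nu the bound is a strict subsolution with B = nu at x = 0, and y > nu.
    For K_nu it is a negative strict supersolution; if y <= B at some point, then
    v = B - y satisfies x v' > v^2 from there on and blows up at a finite x, whereas
    K_nu > 0 for all x > 0: no asymptotics of K_nu are needed. *)

Require Import Defs.
From Stdlib Require Import Reals Lra Lia Factorial.
From Coquelicot Require Import Coquelicot.
Open Scope R_scope.

(** * Riccati comparison *)

Lemma exists_gt_right_of_derive_pos (v : R -> R) (a b l : R) :
  a < b -> is_derive v a l -> 0 < l -> exists c, a <= c <= b /\ v a < v c.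
Proof.
  intros a_lt_b v_derive l_pos.
  apply is_derive_Reals in v_derive.
  destruct (v_derive (l / 2)) as [delta slope_close]; [lra|].
  pose proof (cond_pos delta) as delta_pos.
  set (h := Rmin (delta / 2) (b - a)).
  assert (h_le_delta : h <= delta / 2) by apply Rmin_l.
  assert (h_le_width : h <= b - a) by apply Rmin_r.
  assert (h_pos : 0 < h) by (apply Rmin_pos; lra).
  specialize (slope_close h ltac:(lra) ltac:(rewrite Rabs_pos_eq; lra)).
  apply Rabs_def2 in slope_close.
  exists (a + h). split; [lra|].
  assert (increment : v (a + h) - v a = (v (a + h) - v a) / h * h) by (field; lra).
  nra.
Qed.

(* The maximum over [a, b] can only sit at b. *)
Lemma lt_of_increasing_where_nonneg (v : R -> R) (a b : R) :
  a < b ->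
  (forall t, a <= t <= b -> ex_derive v t) ->
  (forall t, a <= t < b -> 0 <= v t -> 0 < Derive v t) ->
  0 <= v a -> v a < v b.
Proof.
  intros a_lt_b v_derivable v_incr va_nonneg.
  destruct (continuity_ab_maj v a b) as [m [m_max m_in]]; [lra| |].
  { intros t t_in. now apply derivable_continuous_pt, ex_derive_Reals_0, v_derivable. }
  assert (exceeded : forall t, a <= t < b -> 0 <= v t -> v t < v m).
  { intros t t_in vt_nonneg.
    destruct (exists_gt_right_of_derive_pos v t b (Derive v t)) as [c [c_in vc_gt]];
      [lra | apply Derive_correct, v_derivable; lra | now apply v_incr |].
    specialize (m_max c ltac:(lra)). lra. }
  assert (va_lt := exceeded a ltac:(lra) va_nonneg).
  destruct (Rlt_le_dec m b) as [m_lt_b | b_le_m].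
  - specialize (exceeded m ltac:(lra) ltac:(lra)). lra.
  - now replace b with m by lra.
Qed.

Lemma gt_of_decreasing_where_nonneg (v : R -> R) (a b : R) :
  a < b ->
  (forall t, a <= t <= b -> ex_derive v t) ->
  (forall t, a < t <= b -> 0 <= v t -> Derive v t < 0) ->
  0 <= v b -> v b < v a.
Proof.
  intros a_lt_b v_derivable v_decr vb_nonneg.
  assert (reflected_derive : forall t, a <= t <= b ->
    is_derive (fun s => v (a + b - s)) t (- Derive v (a + b - t))).
  { intros t t_in. evar_last.
    - apply (is_derive_comp v (fun s => a + b - s) t (Derive v (a + b - t)) (-1)).
      + apply Derive_correct, v_derivable. lra.
      + auto_derive; [easy | ring].
    - unfold scal; simpl. unfold mult; simpl. ring. }
  assert (reflected := lt_of_increasing_where_nonneg (fun t => v (a + b - t)) a b a_lt_b).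
  cbv beta in reflected.
  replace (a + b - a) with b in reflected by ring.
  replace (a + b - b) with a in reflected by ring.
  apply reflected; [| |exact vb_nonneg].
  - intros t t_in. eexists. now apply reflected_derive.
  - intros t t_in vt_nonneg.
    rewrite (is_derive_unique (fun s : R => v (a + b - s)) t _
      (reflected_derive t ltac:(lra))).
    specialize (v_decr (a + b - t) ltac:(lra) vt_nonneg). lra.
Qed.

(* [1 / v + ln x] decreases, so it cannot stay above [ln x] forever. *)
Lemma sqr_lt_euler_derive_blow_up (v : R -> R) (a : R) :
  0 <= a ->
  (forall x, a < x -> ex_derive v x) ->
  (forall x, a < x -> 0 < v x) ->
  (forall x, a < x -> v x ^ 2 < x * Derive v x) -> False.
Proof.
  intros a_nonneg v_derivable v_pos v_growth.
  set (c := a + 1). set (b := c * exp (/ v c)).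
  assert (inv_vc_pos : 0 < / v c) by (apply Rinv_0_lt_compat, v_pos; unfold c; lra).
  assert (c_lt_b : c < b).
  { assert (exp_gt_1 := exp_ineq1 (/ v c) ltac:(lra)). unfold b, c in *. nra. }
  assert (ln_b : ln b = ln c + / v c).
  { unfold b. rewrite ln_mult, ln_exp; [easy | unfold c; lra | apply exp_pos]. }
  assert (b_vs_c : - / v c - ln c < - / v b - ln b).
  { apply (incr_function (fun t => - / v t - ln t) a p_infty
             (fun t => Derive v t / v t ^ 2 - / t));
      [| |simpl; unfold c; lra | exact c_lt_b | easy].
    - intros t a_lt_t _. simpl in a_lt_t.
      specialize (v_pos t a_lt_t). specialize (v_derivable t a_lt_t).
      evar_last.
      + exact (is_derive_minus _ _ t _ _
          (is_derive_opp _ t _ (is_derive_inv v t _ (Derive_correct v t v_derivable)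
             ltac:(lra)))
          (proj2 (is_derive_Reals ln t _) (derivable_pt_lim_ln t ltac:(lra)))).
      + unfold minus, plus, opp; simpl. field. lra.
    - intros t a_lt_t _. simpl in a_lt_t.
      specialize (v_pos t a_lt_t). specialize (v_growth t a_lt_t).
      replace (Derive v t / v t ^ 2 - / t)
        with ((t * Derive v t - v t ^ 2) / (t * v t ^ 2)) by (field; lra).
      apply Rdiv_lt_0_compat; [lra|].
      apply Rmult_lt_0_compat; [lra | now apply pow_lt]. }
  assert (inv_vb_pos : 0 < / v b) by (apply Rinv_0_lt_compat, v_pos; unfold c in *; lra).
  lra.
Qed.

Lemma exists_close_right (f : R -> R) (a b eps : R) :
  continuous f a -> a < b -> 0 < eps -> exists t, a < t < b /\ Rabs (f t - f a) < eps.
Proof.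
  intros f_cont a_lt_b eps_pos.
  destruct (proj1 (filterlim_locally f (f a)) f_cont (mkposreal eps eps_pos))
    as [delta f_close].
  pose proof (cond_pos delta) as delta_pos.
  set (h := Rmin ((b - a) / 2) (delta / 2)).
  assert (h_le_width : h <= (b - a) / 2) by apply Rmin_l.
  assert (h_le_delta : h <= delta / 2) by apply Rmin_r.
  assert (h_pos : 0 < h) by (apply Rmin_pos; lra).
  exists (a + h). split; [lra|].
  apply (f_close (a + h)). change (Rabs (a + h - a) < delta).
  rewrite Rabs_pos_eq; lra.
Qed.

Definition riccati_solution (f y : R -> R) : Prop :=
  forall x, 0 < x -> is_derive y x ((f x - y x ^ 2) / x).

Definition strict_riccati_subsolution (f y : R -> R) : Prop :=
  forall x, 0 < x -> ex_derive y x /\ x * Derive y x < f x - y x ^ 2.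

Definition strict_riccati_supersolution (f y : R -> R) : Prop :=
  forall x, 0 < x -> ex_derive y x /\ f x - y x ^ 2 < x * Derive y x.

Lemma euler_derive_riccati_gap (f y B : R -> R) (x : R) :
  riccati_solution f y -> ex_derive B x -> 0 < x ->
  ex_derive (fun t => B t - y t) x /\
  x * Derive (fun t => B t - y t) x = x * Derive B x - (f x - y x ^ 2).
Proof.
  intros y_sol B_derivable x_pos.
  assert (gap_derive := is_derive_minus B y x _ _ (Derive_correct B x B_derivable)
    (y_sol x x_pos)).
  split; [eexists; exact gap_derive|].
  rewrite (is_derive_unique (fun t : R => B t - y t) x _ gap_derive).
  unfold minus, plus, opp; simpl. field. lra.
Qed.

Lemma riccati_subsolution_lt (f y L : R -> R) :
  riccati_solution f y -> strict_riccati_subsolution f L ->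
  continuous L 0 -> 0 <= L 0 -> (forall x, 0 < x -> L 0 <= y x) ->
  forall x, 0 < x -> L x < y x.
Proof.
  intros y_sol L_sub L_cont L0_nonneg y_ge x x_pos.
  apply Rnot_le_lt. intros y_le_L.
  set (v := fun t => L t - y t).
  assert (v_decr : forall t, 0 < t -> ex_derive v t /\ (0 <= v t -> Derive v t < 0)).
  { intros t t_pos. destruct (L_sub t t_pos) as [L_derivable L_growth].
    destruct (euler_derive_riccati_gap f y L t y_sol L_derivable t_pos)
      as [v_derivable v_euler].
    split; [exact v_derivable|]. specialize (y_ge t t_pos). fold v in v_euler.
    unfold v at 1. nra. }
  assert (v_gt : forall s t, 0 < s < t -> 0 <= v t -> v t < v s).
  { intros s t s_lt_t. apply gt_of_decreasing_where_nonneg; [lra | |];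
      intros u u_in; apply v_decr; lra. }
  assert (v_half_pos : 0 < v (x / 2)).
  { assert (gt := v_gt (x / 2) x ltac:(lra)). unfold v at 1 2 in gt. lra. }
  destruct (exists_close_right L 0 (x / 2) (v (x / 2)) L_cont ltac:(lra) v_half_pos)
    as [s [s_in L_s]].
  apply Rabs_def2 in L_s.
  assert (v_s := v_gt s (x / 2) ltac:(lra) ltac:(lra)).
  specialize (y_ge s ltac:(lra)). unfold v at 2 in v_s. lra.
Qed.

(* No initial condition is needed: once [y <= U], the gap [v = U - y] satisfies
   [x v' > v ^ 2] and [y] cannot exist for all [x]. *)
Lemma riccati_supersolution_lt (f y U : R -> R) :
  riccati_solution f y -> strict_riccati_supersolution f U ->
  (forall x, 0 < x -> U x <= 0) ->
  forall x, 0 < x -> U x < y x.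
Proof.
  intros y_sol U_super U_nonpos x x_pos.
  apply Rnot_le_lt. intros y_le_U.
  set (v := fun t => U t - y t).
  assert (v_growth : forall t, 0 < t ->
    ex_derive v t /\ (0 <= v t -> v t ^ 2 < t * Derive v t)).
  { intros t t_pos. destruct (U_super t t_pos) as [U_derivable U_growth].
    destruct (euler_derive_riccati_gap f y U t y_sol U_derivable t_pos)
      as [v_derivable v_euler].
    split; [exact v_derivable|]. specialize (U_nonpos t t_pos). fold v in v_euler.
    rewrite v_euler. unfold v. nra. }
  assert (v_pos : forall t, x < t -> 0 < v t).
  { intros t x_lt_t. apply Rle_lt_trans with (v x); [unfold v; lra|].
    apply lt_of_increasing_where_nonneg; [lra | | |unfold v; lra]; intros u u_in.
    - apply v_growth. lra.
    - destruct (v_growth u ltac:(lra)) as [_ growth]. nra. }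
  apply (sqr_lt_euler_derive_blow_up v x); [lra | | exact v_pos |]; intros t x_lt_t.
  - apply v_growth. lra.
  - apply v_growth; [lra | left; now apply v_pos].
Qed.

Definition log_derivative (mu : R) (f g : R -> R) (x : R) : R := x * (g x / f x) - mu.

(* The hypotheses are the recurrence relations of [(I_mu, I_(mu-1))]; the pair
   [(K_nu, - K_(nu+1))] satisfies them with [mu = - nu]. Under the first of them,
   [log_derivative mu f g x] is [x f'(x) / f(x)]. *)
Lemma riccati_solution_log_derivative (mu : R) (f g : R -> R) :
  (forall x, 0 < x -> 0 < f x) ->
  (forall x, 0 < x -> is_derive f x (g x - mu / x * f x)) ->
  (forall x, 0 < x -> is_derive g x (f x + (mu - 1) / x * g x)) ->
  riccati_solution (fun x => x ^ 2 + mu ^ 2) (log_derivative mu f g).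
Proof.
  intros f_pos f_derive g_derive x x_pos. specialize (f_pos x x_pos).
  assert (ratio_derive := is_derive_div _ _ x _ _ (g_derive x x_pos) (f_derive x x_pos)
    ltac:(lra)).
  evar_last.
  - exact (is_derive_minus _ _ x _ _
      (is_derive_mult _ _ x _ _ (is_derive_id x) ratio_derive Rmult_comm)
      (is_derive_const mu x)).
  - unfold log_derivative, minus, plus, opp, mult, zero, one; simpl. field. lra.
Qed.

(** * The algebraic bound *)

Definition cos2 (nu x : R) : R := nu ^ 2 / (nu ^ 2 + x ^ 2).

Definition sin2 (nu x : R) : R := x ^ 2 / (nu ^ 2 + x ^ 2).

Definition cosine (nu x : R) : R := nu / sqrt (nu ^ 2 + x ^ 2).

Definition shrunk_order (nu x : R) : R :=
  sqrt (nu ^ 2 - x ^ 4 / (4 * (x ^ 2 + nu ^ 2) ^ 2)).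

Definition shifted_order (sg nu x : R) : R := sg * cosine nu x + shrunk_order nu x.

Definition radical (sg nu x : R) : R := sqrt (x ^ 2 + shifted_order sg nu x ^ 2).

(* [sg = 1] gives the lower bound for [x I_nu'(x) / I_nu(x)], and [sg = -1] the one for
   [x K_nu'(x) / K_nu(x)]. *)
Definition riccati_bound (sg nu x : R) : R :=
  - (1 / 2 * (1 + cos2 nu x)) + sg * radical sg nu x.

Definition riccati_defect (sg nu x : R) : R :=
  (shifted_order sg nu x - cosine nu x * radical sg nu x) ^ 2
  + sin2 nu x * sg * cosine nu x * (shifted_order sg nu x - cosine nu x * radical sg nu x)
  + sin2 nu x ^ 2 * cos2 nu x * shifted_order sg nu x / (2 * shrunk_order nu x).

Section Angle.

Variables nu x : R.
Hypothesis nu_pos : 0 < nu.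

Local Notation N := (nu ^ 2 + x ^ 2).
Local Notation q := (cos2 nu x).
Local Notation p := (sin2 nu x).
Local Notation r := (cosine nu x).

Lemma sum_sqr_pos : 0 < N.
Proof. nra. Qed.

Lemma sin2_add_cos2 : p + q = 1.
Proof. assert (N_pos := sum_sqr_pos). unfold sin2, cos2. field. lra. Qed.

Lemma cos2_mul_sqr : q * x ^ 2 = p * nu ^ 2.
Proof. assert (N_pos := sum_sqr_pos). unfold sin2, cos2. field. lra. Qed.

Lemma cos2_pos : 0 < q.
Proof. apply Rdiv_lt_0_compat; [nra | exact sum_sqr_pos]. Qed.

Lemma sin2_nonneg : 0 <= p.
Proof.
  apply Rmult_le_pos; [apply pow2_ge_0 | left; apply Rinv_0_lt_compat, sum_sqr_pos].
Qed.

Lemma sin2_pos : 0 < x -> 0 < p.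
Proof. intros x_pos. apply Rdiv_lt_0_compat; [nra | exact sum_sqr_pos]. Qed.

Lemma cosine_pos : 0 < r.
Proof. apply Rdiv_lt_0_compat; [exact nu_pos | apply sqrt_lt_R0, sum_sqr_pos]. Qed.

Lemma cosine_sqr : r ^ 2 = q.
Proof.
  assert (N_pos := sum_sqr_pos).
  assert (sqrt_N_pos := sqrt_lt_R0 _ N_pos).
  unfold cosine, cos2. rewrite <- (pow2_sqrt N) at 2 by lra. field. lra.
Qed.

Lemma is_derive_cos2 : is_derive (cos2 nu) x (- (2 * (x / N) * q)).
Proof.
  assert (N_pos := sum_sqr_pos). unfold cos2.
  auto_derive; [simpl in N_pos; lra | field; lra].
Qed.

Lemma is_derive_cosine : is_derive (cosine nu) x (- (x / N * r)).
Proof.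
  assert (N_pos := sum_sqr_pos).
  assert (sqrt_N_pos := sqrt_lt_R0 _ N_pos).
  assert (N_derive : is_derive (fun t => nu ^ 2 + t ^ 2) x (2 * x))
    by (auto_derive; [easy | ring]).
  evar_last.
  - exact (is_derive_scal _ x nu _
      (is_derive_inv _ x _ (is_derive_sqrt _ x _ N_derive N_pos) ltac:(lra))).
  - unfold cosine.
    replace (x / N) with (x / sqrt N ^ 2) by (rewrite pow2_sqrt by lra; reflexivity).
    field. lra.
Qed.

End Angle.

Section Bound.

Variables nu x : R.
Hypothesis nu_ge : 1 / 2 <= nu.

Local Notation N := (nu ^ 2 + x ^ 2).
Local Notation q := (cos2 nu x).
Local Notation p := (sin2 nu x).
Local Notation r := (cosine nu x).
Local Notation T := (shrunk_order nu x).

Lemma shrunk_order_radicand :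
  nu ^ 2 - x ^ 4 / (4 * (x ^ 2 + nu ^ 2) ^ 2) = nu ^ 2 - p ^ 2 / 4.
Proof.
  assert (N_pos := sum_sqr_pos nu x ltac:(lra)). unfold sin2. field. lra.
Qed.

Lemma shrunk_order_radicand_ge : q / 4 <= nu ^ 2 - p ^ 2 / 4.
Proof.
  assert (pq := sin2_add_cos2 nu x ltac:(lra)).
  assert (p_nonneg := sin2_nonneg nu x ltac:(lra)).
  assert (q_pos := cos2_pos nu x ltac:(lra)). nra.
Qed.

Lemma shrunk_order_sqr : T ^ 2 = nu ^ 2 - p ^ 2 / 4.
Proof.
  assert (q_pos := cos2_pos nu x ltac:(lra)).
  assert (radicand_ge := shrunk_order_radicand_ge).
  unfold shrunk_order. rewrite shrunk_order_radicand. apply pow2_sqrt. lra.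
Qed.

Lemma shrunk_order_pos : 0 < T.
Proof.
  assert (q_pos := cos2_pos nu x ltac:(lra)).
  assert (radicand_ge := shrunk_order_radicand_ge).
  unfold shrunk_order. rewrite shrunk_order_radicand. apply sqrt_lt_R0. lra.
Qed.

Lemma half_cosine_le_shrunk_order : r / 2 <= T.
Proof.
  assert (radicand_ge := shrunk_order_radicand_ge).
  rewrite <- shrunk_order_sqr, <- cosine_sqr in radicand_ge by lra.
  assert (T_pos := shrunk_order_pos). nra.
Qed.

Lemma is_derive_shrunk_order :
  is_derive (shrunk_order nu) x (- (x / N * p * q / (2 * T))).
Proof.
  assert (N_pos := sum_sqr_pos nu x ltac:(lra)). assert (T_pos := shrunk_order_pos).
  assert (q_pos := cos2_pos nu x ltac:(lra)).
  assert (radicand_ge := shrunk_order_radicand_ge).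
  assert (radicand_derive :
    is_derive (fun t => nu ^ 2 - t ^ 4 / (4 * (t ^ 2 + nu ^ 2) ^ 2)) x (- (x / N * p * q))).
  { unfold sin2, cos2. auto_derive; [simpl in N_pos; nra | field; lra]. }
  evar_last.
  - apply (is_derive_sqrt _ x _ radicand_derive). rewrite shrunk_order_radicand. lra.
  - fold (shrunk_order nu x). field. lra.
Qed.

Variable sg : R.

Local Notation W := (shifted_order sg nu x).
Local Notation S := (radical sg nu x).

Lemma is_derive_shifted_order :
  is_derive (shifted_order sg nu) x (- (x / N * (sg * r + p * q / (2 * T)))).
Proof.
  assert (N_pos := sum_sqr_pos nu x ltac:(lra)). assert (T_pos := shrunk_order_pos).
  evar_last.
  - exact (is_derive_plus _ _ x _ _
      (is_derive_scal _ x sg _ (is_derive_cosine nu x ltac:(lra))) is_derive_shrunk_order).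
  - unfold plus; simpl. field. lra.
Qed.

Hypothesis radicand_pos : 0 < x ^ 2 + W ^ 2.

Lemma radical_pos : 0 < S.
Proof. apply sqrt_lt_R0, radicand_pos. Qed.

Lemma radical_sqr : S ^ 2 = x ^ 2 + W ^ 2.
Proof. apply pow2_sqrt. lra. Qed.

Lemma is_derive_radical :
  is_derive (radical sg nu) x ((x - W * (x / N * (sg * r + p * q / (2 * T)))) / S).
Proof.
  assert (T_pos := shrunk_order_pos). assert (S_pos := radical_pos).
  assert (N_pos := sum_sqr_pos nu x ltac:(lra)).
  assert (radicand_derive : is_derive (fun t => t ^ 2 + shifted_order sg nu t ^ 2) x
    (2 * (x - W * (x / N * (sg * r + p * q / (2 * T)))))).
  { evar_last.
    - exact (is_derive_plus _ _ x _ _ (is_derive_pow _ 2 x _ (is_derive_id x))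
        (is_derive_pow _ 2 x _ is_derive_shifted_order)).
    - unfold plus, one; simpl. ring. }
  evar_last.
  - exact (is_derive_sqrt _ x _ radicand_derive radicand_pos).
  - change (sqrt _) with S. field. lra.
Qed.

Lemma is_derive_riccati_bound :
  is_derive (riccati_bound sg nu) x
    (x / N * q + sg * ((x - W * (x / N * (sg * r + p * q / (2 * T)))) / S)).
Proof.
  assert (N_pos := sum_sqr_pos nu x ltac:(lra)).
  apply (is_derive_plus (fun t => - (1 / 2 * (1 + cos2 nu t))) (fun t => sg * radical sg nu t)
    x); [|exact (is_derive_scal _ x sg _ is_derive_radical)].
  evar_last.
  - exact (is_derive_opp _ x _ (is_derive_scal _ x (1 / 2) _
      (is_derive_plus _ _ x _ _ (is_derive_const 1 x) (is_derive_cos2 nu x ltac:(lra))))).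
  - unfold plus, opp, zero; simpl. field. lra.
Qed.

Lemma riccati_bound_defect :
  sg ^ 2 = 1 ->
  (x ^ 2 + nu ^ 2 - riccati_bound sg nu x ^ 2 - x * Derive (riccati_bound sg nu) x) * (sg * S)
  = riccati_defect sg nu x.
Proof.
  intros sg_sqr.
  assert (T_pos := shrunk_order_pos). assert (S_pos := radical_pos).
  assert (euler_derive : x * Derive (riccati_bound sg nu) x
    = p * q + sg * ((x ^ 2 - W * (sg * p * r + p ^ 2 * q / (2 * T))) / S)).
  { assert (N_pos := sum_sqr_pos nu x ltac:(lra)).
    rewrite (is_derive_unique _ _ _ is_derive_riccati_bound).
    unfold sin2. field. lra. }
  assert (p_eq : p = 1 - r ^ 2).
  { assert (pq := sin2_add_cos2 nu x ltac:(lra)). rewrite cosine_sqr by lra. lra. }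
  assert (x_sqr : x ^ 2 = S ^ 2 - W ^ 2) by (rewrite radical_sqr; ring).
  assert (nu_sqr : nu ^ 2 = T ^ 2 + p ^ 2 / 4) by (rewrite shrunk_order_sqr; lra).
  assert (sg_cases : sg = 1 \/ sg = -1).
  { destruct (Rmult_integral (sg - 1) (sg + 1)); [lra | left; lra | right; lra]. }
  rewrite euler_derive. unfold riccati_bound, riccati_defect.
  rewrite x_sqr, nu_sqr, p_eq, <- cosine_sqr by lra.
  unfold shifted_order.
  destruct sg_cases as [-> | ->]; field; lra.
Qed.

End Bound.

Section DefectSign.

Variables nu x : R.
Hypothesis nu_ge : 1 / 2 <= nu.
Hypothesis x_pos : 0 < x.

Local Notation q := (cos2 nu x).
Local Notation p := (sin2 nu x).
Local Notation r := (cosine nu x).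
Local Notation T := (shrunk_order nu x).

Lemma radical_radicand_pos (sg : R) : 0 < x ^ 2 + shifted_order sg nu x ^ 2.
Proof. nra. Qed.

Lemma shrunk_order_lt : T < nu.
Proof.
  assert (T_sqr := shrunk_order_sqr nu x nu_ge).
  assert (p_pos := sin2_pos nu x ltac:(lra) x_pos). nra.
Qed.

Lemma cosine_radical_sqr (sg : R) :
  (r * radical sg nu x) ^ 2 = p * nu ^ 2 + q * shifted_order sg nu x ^ 2.
Proof.
  rewrite <- cos2_mul_sqr, Rpow_mult_distr, cosine_sqr by lra.
  rewrite radical_sqr by apply radical_radicand_pos. ring.
Qed.

Lemma riccati_defect_plus_pos : 0 < riccati_defect 1 nu x.
Proof.
  assert (T_pos := shrunk_order_pos nu x nu_ge).
  assert (r_pos := cosine_pos nu x ltac:(lra)).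
  assert (p_pos := sin2_pos nu x ltac:(lra) x_pos).
  unfold riccati_defect. rewrite <- cosine_sqr by lra.
  set (W := shifted_order 1 nu x). set (D := W - r * radical 1 nu x).
  assert (pr_pos : 0 < p * r) by now apply Rmult_lt_0_compat.
  assert (last_gt : (p * r) ^ 2 / 2 < p ^ 2 * r ^ 2 * W / (2 * T)).
  { replace (p ^ 2 * r ^ 2 * W / (2 * T)) with ((p * r) ^ 2 / 2 + (p * r) ^ 2 * (r / (2 * T)))
      by (unfold W, shifted_order; field; lra).
    enough (0 < (p * r) ^ 2 * (r / (2 * T))) by lra.
    apply Rmult_lt_0_compat; [now apply pow_lt | apply Rdiv_lt_0_compat; lra]. }
  assert (square := pow2_ge_0 (D + p * r / 2)). nra.
Qed.

Lemma cosine_radical_pos (sg : R) : 0 < r * radical sg nu x.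
Proof.
  apply Rmult_lt_0_compat; [apply cosine_pos; lra|].
  apply radical_pos, radical_radicand_pos.
Qed.

Lemma dist_cosine_radical_sqr_ge (sg : R) :
  shifted_order sg nu x < 0 ->
  p * nu ^ 2 <= (shifted_order sg nu x - r * radical sg nu x) ^ 2.
Proof.
  set (W := shifted_order sg nu x). set (rS := r * radical sg nu x). intros W_neg.
  assert (q_pos := cos2_pos nu x ltac:(lra)).
  assert (rS_pos : 0 < rS) by apply cosine_radical_pos.
  assert (rS_sqr : rS ^ 2 = p * nu ^ 2 + q * W ^ 2) by apply cosine_radical_sqr.
  assert (qW_nonneg : 0 <= q * W ^ 2) by (apply Rmult_le_pos; [lra | apply pow2_ge_0]).
  assert (rS_le : rS ^ 2 <= (W - rS) ^ 2) by nra.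
  lra.
Qed.

Local Notation W := (shifted_order (-1) nu x).
Local Notation S := (radical (-1) nu x).

Lemma shifted_order_minus_eq : W = T - r.
Proof. unfold shifted_order. ring. Qed.

Lemma shifted_order_minus_lt_cosine_radical : 0 <= W -> W < r * S.
Proof.
  intros W_nonneg.
  assert (T_lt := shrunk_order_lt).
  assert (r_pos := cosine_pos nu x ltac:(lra)).
  assert (p_pos := sin2_pos nu x ltac:(lra) x_pos).
  assert (pq := sin2_add_cos2 nu x ltac:(lra)).
  assert (rS_pos := cosine_radical_pos (-1)). assert (rS_sqr := cosine_radical_sqr (-1)).
  assert (W_sqr_lt : W ^ 2 < nu ^ 2) by (rewrite shifted_order_minus_eq in *; nra).
  assert (W_sqr_lt_rS : W ^ 2 < (r * S) ^ 2) by nra.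
  nra.
Qed.

Lemma shifted_order_minus_quotient_ge : - (p / 8) <= p ^ 2 * q * W / (2 * T).
Proof.
  assert (T_pos := shrunk_order_pos nu x nu_ge).
  assert (half_r_le_T := half_cosine_le_shrunk_order nu x nu_ge).
  assert (p_pos := sin2_pos nu x ltac:(lra) x_pos).
  assert (q_pos := cos2_pos nu x ltac:(lra)).
  assert (pq := sin2_add_cos2 nu x ltac:(lra)).
  rewrite shifted_order_minus_eq.
  replace (p ^ 2 * q * (T - r) / (2 * T))
    with (p ^ 2 * q * ((2 * T - r) / (2 * T)) - p * (p * q) / 2) by (field; lra).
  assert (pq_le : p * q <= 1 / 4) by (assert (square := pow2_ge_0 (p - q)); nra).
  enough (0 <= p ^ 2 * q * ((2 * T - r) / (2 * T))) by nra.
  apply Rmult_le_pos; [apply Rmult_le_pos; [apply pow2_ge_0 | lra]|].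
  apply Rmult_le_pos; [lra | left; apply Rinv_0_lt_compat; lra].
Qed.

Lemma riccati_defect_minus_pos : 0 < riccati_defect (-1) nu x.
Proof.
  assert (p_pos := sin2_pos nu x ltac:(lra) x_pos).
  assert (pr_pos : 0 < p * r) by (apply Rmult_lt_0_compat, cosine_pos; lra).
  assert (rS_pos := cosine_radical_pos (-1)).
  unfold riccati_defect.
  destruct (Rle_lt_dec 0 W) as [W_nonneg | W_neg].
  - assert (W_lt := shifted_order_minus_lt_cosine_radical W_nonneg).
    assert (last_nonneg : 0 <= p ^ 2 * q * W / (2 * T)).
    { apply Rmult_le_pos.
      - apply Rmult_le_pos, W_nonneg.
        apply Rmult_le_pos; [apply pow2_ge_0 | left; apply cos2_pos; lra].
      - left. apply Rinv_0_lt_compat, Rmult_lt_0_compat; [lra | now apply shrunk_order_pos]. }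
    nra.
  - assert (D_sqr_ge := dist_cosine_radical_sqr_ge (-1) W_neg).
    assert (last_ge := shifted_order_minus_quotient_ge).
    assert (nu_sqr_ge : 1 / 4 <= nu ^ 2) by nra.
    assert (p_nu_ge : p / 4 <= p * nu ^ 2) by nra.
    nra.
Qed.

End DefectSign.

Lemma riccati_bound_plus_subsolution (nu : R) :
  1 / 2 <= nu -> strict_riccati_subsolution (fun x => x ^ 2 + nu ^ 2) (riccati_bound 1 nu).
Proof.
  intros nu_ge x x_pos.
  assert (radicand := radical_radicand_pos nu x x_pos 1). split.
  - eexists. now apply is_derive_riccati_bound.
  - assert (S_pos := radical_pos nu x 1 radicand).
    assert (defect_pos := riccati_defect_plus_pos nu x nu_ge x_pos).
    rewrite <- riccati_bound_defect in defect_pos by (assumption || ring). nra.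
Qed.

Lemma riccati_bound_minus_supersolution (nu : R) :
  1 / 2 <= nu ->
  strict_riccati_supersolution (fun x => x ^ 2 + nu ^ 2) (riccati_bound (-1) nu).
Proof.
  intros nu_ge x x_pos.
  assert (radicand := radical_radicand_pos nu x x_pos (-1)). split.
  - eexists. now apply is_derive_riccati_bound.
  - assert (S_pos := radical_pos nu x (-1) radicand).
    assert (defect_pos := riccati_defect_minus_pos nu x nu_ge x_pos).
    rewrite <- riccati_bound_defect in defect_pos by (assumption || ring). nra.
Qed.

Lemma riccati_bound_minus_neg (nu x : R) : 0 < nu -> riccati_bound (-1) nu x < 0.
Proof.
  intros nu_pos. assert (q_pos := cos2_pos nu x nu_pos).
  assert (S_nonneg : 0 <= radical (-1) nu x) by apply sqrt_pos.
  unfold riccati_bound. lra.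
Qed.

Lemma riccati_bound_plus_at_0 (nu : R) : 0 < nu -> riccati_bound 1 nu 0 = nu.
Proof.
  intros nu_pos. unfold riccati_bound, radical, shifted_order, cosine, cos2, shrunk_order.
  replace (nu ^ 2 + 0 ^ 2) with (nu ^ 2) by ring.
  replace (nu ^ 2 - 0 ^ 4 / (4 * (0 ^ 2 + nu ^ 2) ^ 2)) with (nu ^ 2) by (field; nra).
  rewrite sqrt_pow2 by lra.
  replace (0 ^ 2 + (1 * (nu / nu) + nu) ^ 2) with ((1 + nu) ^ 2) by (field; lra).
  rewrite sqrt_pow2 by lra. field. nra.
Qed.

Lemma riccati_bound_plus_continuous_at_0 (nu : R) :
  1 / 2 <= nu -> continuous (riccati_bound 1 nu) 0.
Proof.
  intros nu_ge. apply (ex_derive_continuous (riccati_bound 1 nu)).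
  eexists. apply is_derive_riccati_bound; [exact nu_ge|].
  assert (T_pos := shrunk_order_pos nu 0 nu_ge).
  assert (r_pos := cosine_pos nu 0 ltac:(lra)).
  unfold shifted_order. nra.
Qed.

(** * The reciprocal Gamma function *)

Lemma exp_le (a b : R) : a <= b -> exp a <= exp b.
Proof. intros [a_lt_b | ->]; [left; now apply exp_increasing | lra]. Qed.

Lemma exp_tangent_le (a c : R) : exp c * (1 + (a - c)) <= exp a.
Proof.
  replace (exp a) with (exp c * exp (a - c)) by (rewrite <- exp_plus; f_equal; ring).
  apply Rmult_le_compat_l; [left; apply exp_pos | apply exp_ineq1_le].
Qed.

(* Convexity of [exp] between 0 and [ln (1 + h)]. *)
Lemma Rpower_le_Bernoulli (h z : R) : -1 < h -> 0 <= z <= 1 -> Rpower (1 + h) z <= 1 + z * h.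
Proof.
  intros h_gt z_in. unfold Rpower. set (a := ln (1 + h)).
  assert (at_a := exp_tangent_le a (z * a)).
  assert (at_0 := exp_tangent_le 0 (z * a)).
  assert (exp_a : exp a = 1 + h) by (apply exp_ln; lra).
  rewrite exp_a in at_a. rewrite exp_0 in at_0. nra.
Qed.

Lemma Bernoulli_mul_Rpower_le (u z : R) :
  u < 1 -> 0 <= z -> 0 <= 1 + z * u -> (1 + z * u) * Rpower (1 - u) z <= 1.
Proof.
  intros u_lt z_nonneg factor_nonneg.
  assert (power_le : Rpower (1 - u) z <= exp (- (z * u))).
  { replace (exp (- (z * u))) with (Rpower (exp (- u)) z)
      by (unfold Rpower; rewrite ln_exp; f_equal; ring).
    apply Rle_Rpower_l; [exact z_nonneg|].
    assert (tangent := exp_ineq1_le (- u)). lra. }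
  apply Rle_trans with (exp (z * u) * exp (- (z * u))).
  - apply Rmult_le_compat;
      [exact factor_nonneg | left; apply exp_pos | apply exp_ineq1_le | exact power_le].
  - rewrite <- exp_plus, Rplus_opp_r, exp_0. lra.
Qed.

(* [z (z + 1) ... (z + n)], with [n + 1] factors. *)
Definition rising_product (z : R) (n : nat) : R := prod_f_R0 (fun k => z + INR k) n.

Definition rGamma_seq (z : R) (n : nat) : R :=
  rising_product z n / (INR (fact n) * Rpower (INR n) z).

Lemma INR_S_pos (n : nat) : 0 < INR (S n).
Proof. apply lt_0_INR. lia. Qed.

Lemma is_lim_inv_INR_S : is_lim_seq (fun n => / INR (S n)) 0.
Proof.
  apply (is_lim_seq_incr_1 (fun n => / INR n)).
  apply (is_lim_seq_inv INR p_infty); [apply is_lim_seq_INR | easy].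
Qed.

Lemma rising_product_S (z : R) (n : nat) :
  rising_product z (S n) = rising_product z n * (z + INR (S n)).
Proof. reflexivity. Qed.

Lemma rising_product_shift (z : R) (n : nat) :
  z * rising_product (z + 1) n = rising_product z n * (z + INR n + 1).
Proof.
  induction n as [|n IH].
  - unfold rising_product. simpl. ring.
  - rewrite !rising_product_S, <- Rmult_assoc, IH, S_INR. ring.
Qed.

Lemma rising_product_pos (z : R) (n : nat) : 0 < z -> 0 < rising_product z n.
Proof.
  intros z_pos. induction n as [|n IH].
  - unfold rising_product. simpl. lra.
  - assert (n_pos := INR_S_pos n).
    rewrite rising_product_S. apply Rmult_lt_0_compat; lra.
Qed.

Lemma rising_product_ge (z : R) (n : nat) :
  0 < z <= 1 -> z * INR (fact n) * Rpower (INR n + 1) z <= rising_product z n.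
Proof.
  intros z_in. induction n as [|n IH].
  - unfold rising_product, Rpower. simpl. rewrite Rplus_0_l, ln_1, Rmult_0_r, exp_0. lra.
  - set (m := INR (S n)). assert (m_pos : 0 < m) by apply INR_S_pos.
    assert (m_eq : m = INR n + 1) by apply S_INR. rewrite <- m_eq in IH.
    assert (inv_m_pos := Rinv_0_lt_compat m m_pos).
    assert (bernoulli : Rpower (1 + / m) z <= 1 + z * / m)
      by (apply Rpower_le_Bernoulli; lra).
    assert (power_le : m * Rpower (m + 1) z <= Rpower m z * (z + m)).
    { replace (m + 1) with (m * (1 + / m)) by (field; lra).
      rewrite <- Rpower_mult_distr by lra.
      replace (Rpower m z * (z + m)) with (m * Rpower m z * (1 + z * / m)) by (field; lra).
      rewrite <- Rmult_assoc. apply Rmult_le_compat_l; [|exact bernoulli].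
      apply Rmult_le_pos; [lra | left; apply exp_pos]. }
    rewrite rising_product_S, fact_simpl, mult_INR. fold m.
    apply Rle_trans with (z * INR (fact n) * Rpower m z * (z + m)).
    + replace (z * (m * INR (fact n)) * Rpower (m + 1) z)
        with (z * INR (fact n) * (m * Rpower (m + 1) z)) by ring.
      rewrite (Rmult_assoc _ (Rpower m z)). apply Rmult_le_compat_l; [|exact power_le].
      apply Rmult_le_pos; [lra | apply pos_INR].
    + apply Rmult_le_compat_r; lra.
Qed.

Lemma rGamma_seq_pos (z : R) (n : nat) : 0 < z -> 0 < rGamma_seq z n.
Proof.
  intros z_pos. apply Rdiv_lt_0_compat; [now apply rising_product_pos|].
  apply Rmult_lt_0_compat; [apply INR_fact_lt_0 | apply exp_pos].
Qed.

Lemma rGamma_seq_decreasing (z : R) (n : nat) :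
  0 < z -> rGamma_seq z (S (S n)) <= rGamma_seq z (S n).
Proof.
  intros z_pos.
  set (m := INR (S (S n))).
  assert (n_pos := INR_S_pos n). assert (m_eq : m = INR (S n) + 1) by apply S_INR.
  assert (inv_m_pos : 0 < / m) by (apply Rinv_0_lt_compat; lra).
  assert (inv_m_lt : / m < 1) by (rewrite <- Rinv_1; apply Rinv_lt_contravar; lra).
  assert (ratio : rGamma_seq z (S (S n))
    = rGamma_seq z (S n) * ((1 + z * / m) * Rpower (1 - / m) z)).
  { assert (power : Rpower (INR (S n)) z = Rpower (1 - / m) z * Rpower m z).
    { rewrite Rpower_mult_distr by lra. f_equal. rewrite m_eq. field. lra. }
    assert (fact_pos := INR_fact_lt_0 (S n)).
    assert (power_pos : 0 < Rpower (1 - / m) z) by apply exp_pos.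
    assert (power_m_pos : 0 < Rpower m z) by apply exp_pos.
    unfold rGamma_seq. rewrite rising_product_S, (fact_simpl (S n)), mult_INR. fold m.
    rewrite power. field. lra. }
  rewrite ratio. rewrite <- (Rmult_1_r (rGamma_seq z (S n))) at 2.
  apply Rmult_le_compat_l; [left; now apply rGamma_seq_pos|].
  apply Bernoulli_mul_Rpower_le; [lra | lra | nra].
Qed.

Lemma is_lim_rGamma_seq (z : R) : 0 < z -> is_lim_seq (rGamma_seq z) (rGamma z).
Proof.
  intros z_pos. apply Lim_seq_correct'.
  destruct (ex_finite_lim_seq_decr (fun n => rGamma_seq z (S n)) 0) as [l limit].
  - intros n. now apply rGamma_seq_decreasing.
  - intros n. left. now apply rGamma_seq_pos.
  - exists l. now apply is_lim_seq_incr_1.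
Qed.

Lemma rGamma_ge_self (z : R) : 0 < z <= 1 -> z <= rGamma z.
Proof.
  intros z_in.
  change (Rbar_le z (rGamma z)).
  apply (is_lim_seq_le (fun _ => z) (fun n => rGamma_seq z (S n))).
  - intros n. assert (n_pos := INR_S_pos n).
    assert (fact_pos := INR_fact_lt_0 (S n)).
    assert (power_pos : 0 < Rpower (INR (S n)) z) by apply exp_pos.
    apply Rle_div_r; [now apply Rmult_lt_0_compat|].
    eapply Rle_trans; [|now apply rising_product_ge].
    rewrite <- Rmult_assoc. apply Rmult_le_compat_l; [nra|].
    apply Rle_Rpower_l; lra.
  - apply is_lim_seq_const.
  - apply (is_lim_seq_incr_1 (rGamma_seq z)). apply is_lim_rGamma_seq. lra.
Qed.

Lemma rGamma_rec (z : R) : 0 < z -> rGamma z = z * rGamma (z + 1).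
Proof.
  intros z_pos.
  assert (lim_right : is_lim_seq (fun n => z * rGamma_seq (z + 1) (S n)) (z * rGamma (z + 1))).
  { apply (is_lim_seq_scal_l _ z (rGamma (z + 1))).
    apply (is_lim_seq_incr_1 (rGamma_seq (z + 1))). apply is_lim_rGamma_seq. lra. }
  assert (lim_left : is_lim_seq (fun n => rGamma_seq z (S n) * (1 + (z + 1) * / INR (S n)))
                       (rGamma z * (1 + (z + 1) * 0))).
  { apply is_lim_seq_mult'.
    - apply (is_lim_seq_incr_1 (rGamma_seq z)). now apply is_lim_rGamma_seq.
    - apply is_lim_seq_plus'; [apply is_lim_seq_const|].
      apply is_lim_seq_mult'; [apply is_lim_seq_const | exact is_lim_inv_INR_S]. }
  apply (is_lim_seq_ext _ (fun n => z * rGamma_seq (z + 1) (S n))) in lim_left.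
  - apply is_lim_seq_unique in lim_right. apply is_lim_seq_unique in lim_left.
    rewrite lim_right in lim_left. injection lim_left as limits_eq. lra.
  - intros n. unfold rGamma_seq.
    assert (n_pos := INR_S_pos n).
    assert (fact_pos := INR_fact_lt_0 (S n)).
    assert (power_pos : 0 < Rpower (INR (S n)) z) by apply exp_pos.
    unfold Rdiv at 2. rewrite <- Rmult_assoc, rising_product_shift.
    rewrite Rpower_plus, Rpower_1 by exact n_pos.
    field. lra.
Qed.

Lemma rGamma_pos (z : R) : 0 < z -> 0 < rGamma z.
Proof.
  intros z_pos.
  assert (up_to : forall n u, 0 < u <= INR n + 1 -> 0 < rGamma u).
  { induction n as [|n IH]; intros u u_in.
    - simpl in u_in. assert (ge := rGamma_ge_self u ltac:(lra)). lra.
    - rewrite S_INR in u_in. destruct (Rle_lt_dec u 1) as [u_le | u_gt].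
      + assert (ge := rGamma_ge_self u ltac:(lra)). lra.
      + specialize (IH (u - 1) ltac:(lra)). rewrite rGamma_rec in IH by lra.
        replace (u - 1 + 1) with u in IH by ring. nra. }
  destruct (nfloor_ex z ltac:(lra)) as [n n_floor].
  apply (up_to n). lra.
Qed.

(** * The function I_nu *)

Lemma PSeries_pos (a : nat -> R) (x : R) :
  0 < a 0%nat -> (forall n, 0 <= a n) -> 0 <= x -> ex_pseries a x -> 0 < PSeries a x.
Proof.
  intros a0_pos a_nonneg x_nonneg a_cvg.
  assert (tail_nonneg : PSeries (fun _ => 0) x <= PSeries (PS_decr_1 a) x).
  { apply Series_le.
    - intros n. rewrite Rmult_0_l. split; [lra|].
      apply Rmult_le_pos; [apply a_nonneg | now apply pow_le].
    - assert (tail_cvg : ex_pseries (PS_decr_1 a) x); [|now apply ex_pseries_R].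
      apply ex_pseries_decr_1; [|exact a_cvg].
      destruct (Req_dec x 0) as [x_eq | x_neq]; [now left | right].
      exists (/ x). now apply Rinv_l. }
  rewrite PSeries_const_0 in tail_nonneg.
  rewrite PSeries_decr_1 by exact a_cvg. nra.
Qed.

Definition bessel_coef (nu : R) (k : nat) : R := rGamma (nu + INR k + 1) / INR (fact k).

Definition bessel_entire (nu : R) : R -> R := PSeries (bessel_coef nu).

Lemma bessel_coef_pos (nu : R) (k : nat) : -1 < nu -> 0 < bessel_coef nu k.
Proof.
  intros nu_gt. assert (k_nonneg := pos_INR k).
  apply Rdiv_lt_0_compat; [apply rGamma_pos; lra | apply INR_fact_lt_0].
Qed.

Lemma bessel_coef_S (nu : R) (k : nat) :
  INR (S k) * bessel_coef nu (S k) = bessel_coef (nu + 1) k.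
Proof.
  assert (k_pos := INR_S_pos k). assert (fact_pos := INR_fact_lt_0 k).
  unfold bessel_coef. rewrite fact_simpl, mult_INR.
  replace (nu + INR (S k) + 1) with (nu + 1 + INR k + 1) by (rewrite S_INR; ring).
  field. lra.
Qed.

Lemma bessel_coef_pred_order (nu : R) (k : nat) :
  0 < nu -> bessel_coef (nu - 1) k = (nu + INR k) * bessel_coef nu k.
Proof.
  intros nu_pos. assert (k_nonneg := pos_INR k). unfold bessel_coef.
  replace (nu - 1 + INR k + 1) with (nu + INR k) by ring.
  rewrite rGamma_rec by lra. unfold Rdiv. ring.
Qed.

Lemma bessel_coef_ratio (nu : R) (k : nat) :
  -1 < nu -> bessel_coef nu (S k) / bessel_coef nu k = / (nu + 1 + INR k) * / INR (S k).
Proof.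
  intros nu_gt. assert (k_nonneg := pos_INR k). assert (k_pos := INR_S_pos k).
  assert (coef_pos := bessel_coef_pos nu (S k) nu_gt).
  assert (pred := bessel_coef_pred_order (nu + 1) k ltac:(lra)).
  rewrite <- bessel_coef_S in pred. replace (nu + 1 - 1) with nu in pred by ring.
  rewrite pred. field. lra.
Qed.

Lemma bessel_coef_radius (nu : R) : -1 < nu -> CV_radius (bessel_coef nu) = p_infty.
Proof.
  intros nu_gt. apply CV_radius_infinite_DAlembert.
  - intros k. apply Rgt_not_eq. now apply bessel_coef_pos.
  - apply (is_lim_seq_le_le (fun _ => 0) _ (fun k => / (nu + 1) * / INR (S k))).
    + intros k. split; [apply Rabs_pos|].
      assert (k_nonneg := pos_INR k).
      assert (inv_pos : 0 < / INR (S k)) by apply Rinv_0_lt_compat, INR_S_pos.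
      assert (order_pos : 0 < / (nu + 1 + INR k)) by (apply Rinv_0_lt_compat; lra).
      rewrite bessel_coef_ratio, Rabs_pos_eq by (assumption || nra).
      apply Rmult_le_compat_r; [lra | apply Rinv_le_contravar; lra].
    + apply is_lim_seq_const.
    + replace (Finite 0) with (Finite (/ (nu + 1) * 0)) by (f_equal; ring).
      apply is_lim_seq_mult'; [apply is_lim_seq_const | exact is_lim_inv_INR_S].
Qed.

Lemma ex_pseries_bessel_coef (nu s : R) : -1 < nu -> ex_pseries (bessel_coef nu) s.
Proof. intros nu_gt. apply CV_radius_inside. now rewrite bessel_coef_radius. Qed.

Lemma bessel_entire_pos (nu s : R) : -1 < nu -> 0 <= s -> 0 < bessel_entire nu s.
Proof.
  intros nu_gt s_nonneg. apply PSeries_pos; [| |exact s_nonneg|].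
  - now apply bessel_coef_pos.
  - intros k. left. now apply bessel_coef_pos.
  - now apply ex_pseries_bessel_coef.
Qed.

Lemma is_derive_bessel_entire (nu s : R) :
  -1 < nu -> is_derive (bessel_entire nu) s (bessel_entire (nu + 1) s).
Proof.
  intros nu_gt. unfold bessel_entire.
  rewrite <- (PSeries_ext (PS_derive (bessel_coef nu))) by apply bessel_coef_S.
  apply is_derive_PSeries. now rewrite bessel_coef_radius.
Qed.

Lemma bessel_entire_rec (nu s : R) :
  0 < nu ->
  bessel_entire (nu - 1) s = nu * bessel_entire nu s + s * bessel_entire (nu + 1) s.
Proof.
  intros nu_pos. unfold bessel_entire.
  rewrite <- PSeries_incr_1, <- PSeries_scal, <- PSeries_plus.
  - apply PSeries_ext. intros [|k]; rewrite bessel_coef_pred_order by exact nu_pos.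
    + unfold PS_plus, PS_scal, PS_incr_1, plus, scal, zero; simpl. unfold mult; simpl. ring.
    + change (PS_plus _ _ (S k)) with (nu * bessel_coef nu (S k) + bessel_coef (nu + 1) k).
      rewrite <- bessel_coef_S. ring.
  - apply ex_pseries_scal; [apply Rmult_comm | apply ex_pseries_bessel_coef; lra].
  - apply ex_pseries_incr_1, ex_pseries_bessel_coef. lra.
Qed.

Lemma BesselI_entire (nu x : R) :
  0 < x -> BesselI nu x = Rpower (x / 2) nu * bessel_entire nu (x ^ 2 / 4).
Proof.
  intros x_pos. unfold BesselI, bessel_entire, PSeries.
  rewrite <- Series_scal_l. apply Series_ext. intros k.
  rewrite Rpower_plus.
  replace (2 * INR k) with (INR (2 * k)) by (rewrite mult_INR; simpl; ring).
  rewrite Rpower_pow, pow_mult by lra.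
  replace ((x / 2) ^ 2) with (x ^ 2 / 4) by field.
  unfold bessel_coef, Rdiv. ring.
Qed.

Lemma Rpower_S (x z : R) : 0 < x -> Rpower x (z + 1) = x * Rpower x z.
Proof. intros x_pos. rewrite Rpower_plus, Rpower_1 by exact x_pos. ring. Qed.

Lemma BesselI_pos (nu x : R) : -1 < nu -> 0 < x -> 0 < BesselI nu x.
Proof.
  intros nu_gt x_pos. rewrite BesselI_entire by exact x_pos.
  apply Rmult_lt_0_compat; [apply exp_pos | apply bessel_entire_pos; [exact nu_gt | nra]].
Qed.

Lemma BesselI_rec (nu x : R) :
  0 < nu -> 0 < x -> BesselI (nu - 1) x = BesselI (nu + 1) x + 2 * nu / x * BesselI nu x.
Proof.
  intros nu_pos x_pos. rewrite !BesselI_entire, bessel_entire_rec by assumption.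
  rewrite (Rpower_S _ nu) by lra.
  replace (Rpower (x / 2) nu) with (x / 2 * Rpower (x / 2) (nu - 1))
    by (rewrite <- Rpower_S by lra; f_equal; ring).
  field. lra.
Qed.

Lemma is_derive_BesselI (nu x : R) :
  -1 < nu -> 0 < x ->
  is_derive (BesselI nu) x (BesselI (nu + 1) x + nu / x * BesselI nu x).
Proof.
  intros nu_gt x_pos.
  apply (is_derive_ext_loc (fun t => Rpower (t / 2) nu * bessel_entire nu (t ^ 2 / 4))).
  { apply (filter_imp (fun t => 0 < t)); [|exact (open_gt 0 x x_pos)].
    intros t t_pos. now rewrite BesselI_entire. }
  assert (power_derive : is_derive (fun t => Rpower (t / 2) nu) x
    (nu / x * Rpower (x / 2) nu)).
  { unfold Rpower, Rdiv. auto_derive; [lra | field; lra]. }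
  assert (entire_derive : is_derive (fun t => bessel_entire nu (t ^ 2 / 4)) x
    (x / 2 * bessel_entire (nu + 1) (x ^ 2 / 4))).
  { apply (is_derive_comp (bessel_entire nu) (fun t => t ^ 2 / 4) x).
    - now apply is_derive_bessel_entire.
    - auto_derive; [easy | field]. }
  evar_last.
  - exact (is_derive_mult _ _ x _ _ power_derive entire_derive Rmult_comm).
  - rewrite !BesselI_entire, (Rpower_S _ nu) by lra.
    unfold plus, mult; simpl. ring.
Qed.

Lemma is_derive_BesselI_pred (nu x : R) :
  0 < nu -> 0 < x -> is_derive (BesselI nu) x (BesselI (nu - 1) x - nu / x * BesselI nu x).
Proof.
  intros nu_pos x_pos. evar_last; [apply is_derive_BesselI; lra|].
  rewrite (BesselI_rec nu x nu_pos x_pos). field. lra.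
Qed.

Definition log_derivative_I (nu : R) : R -> R :=
  log_derivative nu (BesselI nu) (BesselI (nu - 1)).

Lemma riccati_solution_I (nu : R) :
  0 < nu -> riccati_solution (fun x => x ^ 2 + nu ^ 2) (log_derivative_I nu).
Proof.
  intros nu_pos. apply riccati_solution_log_derivative; intros x x_pos.
  - apply BesselI_pos; lra.
  - now apply is_derive_BesselI_pred.
  - evar_last; [apply is_derive_BesselI; lra|].
    now replace (nu - 1 + 1) with nu by ring.
Qed.

Lemma log_derivative_I_gt (nu x : R) : 0 < nu -> 0 < x -> nu < log_derivative_I nu x.
Proof.
  intros nu_pos x_pos.
  assert (I_pos := BesselI_pos nu x ltac:(lra) x_pos).
  assert (I_S_pos := BesselI_pos (nu + 1) x ltac:(lra) x_pos).
  assert (ratio_pos := Rdiv_lt_0_compat _ _ I_S_pos I_pos).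
  unfold log_derivative_I, log_derivative. rewrite (BesselI_rec nu x nu_pos x_pos).
  replace (x * ((BesselI (nu + 1) x + 2 * nu / x * BesselI nu x) / BesselI nu x) - nu)
    with (nu + x * (BesselI (nu + 1) x / BesselI nu x)) by (field; lra).
  nra.
Qed.

Lemma riccati_bound_plus_lt_log_derivative_I (nu x : R) :
  1 / 2 <= nu -> 0 < x -> riccati_bound 1 nu x < log_derivative_I nu x.
Proof.
  intros nu_ge. assert (at_0 := riccati_bound_plus_at_0 nu ltac:(lra)).
  apply (riccati_subsolution_lt (fun x => x ^ 2 + nu ^ 2)).
  - apply riccati_solution_I. lra.
  - now apply riccati_bound_plus_subsolution.
  - now apply riccati_bound_plus_continuous_at_0.
  - lra.
  - intros t t_pos. rewrite at_0. left. apply log_derivative_I_gt; lra.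
Qed.

(** * Integrals over a ray *)

Local Notation is_RInt_ray f a l := (is_RInt_gen f (at_point a) (Rbar_locally p_infty) l).

Lemma filter_prod_ray (a : R) (P : R * R -> Prop) :
  (forall b, a <= b -> P (a, b)) ->
  filter_prod (at_point a) (Rbar_locally p_infty) P.
Proof.
  intros P_ray. apply (Filter_prod _ _ _ (fun c => c = a) (fun b => a < b)).
  - reflexivity.
  - now exists a.
  - intros c b -> a_lt_b. apply P_ray. lra.
Qed.

Lemma is_RInt_ray_ext (f g : R -> R) (a l : R) :
  (forall t, f t = g t) -> is_RInt_ray f a l -> is_RInt_ray g a l.
Proof.
  intros f_eq_g. apply is_RInt_gen_ext, filter_prod_ray. intros b _ t _. apply f_eq_g.
Qed.

Lemma is_RInt_ray_lin (f g : R -> R) (a u v lf lg : R) :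
  is_RInt_ray f a lf -> is_RInt_ray g a lg ->
  is_RInt_ray (fun t => u * f t + v * g t) a (u * lf + v * lg).
Proof.
  intros f_int g_int.
  exact (is_RInt_gen_plus _ _ _ _ (is_RInt_gen_scal f u lf f_int)
           (is_RInt_gen_scal g v lg g_int)).
Qed.

Lemma is_RInt_ray_le (f g : R -> R) (a lf lg : R) :
  (forall t, a <= t -> Rabs (f t) <= g t) ->
  is_RInt_ray f a lf -> is_RInt_ray g a lg -> Rabs lf <= lg.
Proof.
  intros f_le_g. apply (RInt_gen_norm (V := R_CompleteNormedModule)).
  - now apply filter_prod_ray.
  - apply filter_prod_ray. intros b _ t t_in. now apply f_le_g.
Qed.

Lemma is_RInt_ray_of_is_lim (f F : R -> R) (a l : R) :
  (forall b, a <= b -> is_RInt f a b (F b)) -> is_lim F p_infty l -> is_RInt_ray f a l.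
Proof.
  intros F_int F_lim P P_near.
  destruct (F_lim P P_near) as [M F_in_P].
  apply (Filter_prod _ _ _ (fun c => c = a) (fun b => Rmax a M < b)).
  - reflexivity.
  - now exists (Rmax a M).
  - intros c b -> b_gt. assert (a_le := Rmax_l a M). assert (M_le := Rmax_r a M).
    exists (F b). split; [apply F_int; simpl; lra | apply F_in_P; lra].
Qed.

Lemma is_RInt_ray_derive (G g : R -> R) (a l : R) :
  (forall t, is_derive G t (g t)) -> (forall t, continuous g t) ->
  is_lim G p_infty l -> is_RInt_ray g a (l - G a).
Proof.
  intros G_derive g_cont G_lim.
  apply (is_RInt_ray_of_is_lim g (fun b => G b - G a)).
  - intros b _. apply (is_RInt_derive G g); intros t _; [apply G_derive | apply g_cont].
  - apply is_lim_minus'; [exact G_lim | apply is_lim_const].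
Qed.

Lemma is_lim_nondecreasing_bounded (F : R -> R) (a M : R) :
  (forall s t, a <= s <= t -> F s <= F t) -> (forall t, a <= t -> F t <= M) ->
  exists l : R, is_lim F p_infty l /\ forall t, a <= t -> F t <= l.
Proof.
  intros F_mono F_le.
  destruct (completeness (fun y => exists t, a <= t /\ y = F t)) as [l [l_ub l_least]].
  - exists M. intros y [t [a_le_t ->]]. now apply F_le.
  - exists (F a), a. split; [lra | easy].
  - assert (F_le_l : forall t, a <= t -> F t <= l)
      by (intros t a_le_t; apply l_ub; now exists t).
    exists l. split; [|exact F_le_l].
    apply is_lim_spec. intros eps. pose proof (cond_pos eps) as eps_pos.
    assert (near : exists s, a <= s /\ l - eps < F s).
    { apply Classical_Prop.NNPP. intros none.
      enough (l <= l - eps) by lra.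
      apply l_least. intros y [t [a_le_t ->]].
      apply Rnot_lt_le. intros F_t_gt. apply none. now exists t. }
    destruct near as [s [a_le_s F_s]].
    exists s. intros t s_lt_t.
    assert (F_s_le := F_mono s t ltac:(lra)). specialize (F_le_l t ltac:(lra)).
    apply Rabs_def1; lra.
Qed.

Lemma ex_RInt_ray_bounded (f : R -> R) (a M : R) :
  (forall t, continuous f t) -> (forall t, a <= t -> 0 <= f t) ->
  (forall b, a <= b -> RInt f a b <= M) ->
  exists l : R, is_RInt_ray f a l /\ forall b, a <= b -> RInt f a b <= l.
Proof.
  intros f_cont f_nonneg f_le.
  assert (f_int : forall b c, ex_RInt f b c).
  { intros b c. apply (ex_RInt_continuous (V := R_CompleteNormedModule)).
    intros t _. apply f_cont. }
  destruct (is_lim_nondecreasing_bounded (RInt f a) a M) as [l [l_lim l_ge]]; [|exact f_le|].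
  - intros b c a_le_b. rewrite <- (RInt_Chasles f a b c) by apply f_int.
    assert (rest_nonneg : 0 <= RInt f b c).
    { apply RInt_ge_0; [lra | apply f_int | intros t t_in; apply f_nonneg; lra]. }
    unfold plus; simpl. lra.
  - exists l. split; [|exact l_ge].
    apply (is_RInt_ray_of_is_lim f (RInt f a)); [|exact l_lim].
    intros b _. apply (RInt_correct (V := R_CompleteNormedModule)), f_int.
Qed.

Lemma is_RInt_exp_opp (M a b : R) :
  is_RInt (fun t => M * exp (- t)) a b (M * exp (- a) - M * exp (- b)).
Proof.
  evar_last.
  - apply (is_RInt_derive (fun t => - M * exp (- t)) (fun t => M * exp (- t))).
    + intros t _. auto_derive; [easy | ring].
    + intros t _. apply (ex_derive_continuous (fun t => M * exp (- t))). now auto_derive.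
  - unfold minus, plus, opp; simpl. ring.
Qed.

Lemma ex_RInt_ray_exp_bound (f : R -> R) (a M : R) :
  (forall t, continuous f t) -> (forall t, a <= t -> 0 <= f t <= M * exp (- t)) ->
  exists l : R, is_RInt_ray f a l /\ forall b, a <= b -> RInt f a b <= l.
Proof.
  intros f_cont f_bound.
  apply (ex_RInt_ray_bounded f a (M * exp (- a)) f_cont); [intros t t_ge; now apply f_bound|].
  intros b a_le_b. apply Rle_trans with (RInt (fun t => M * exp (- t)) a b).
  - apply RInt_le; [exact a_le_b | | eexists; apply is_RInt_exp_opp |].
    + apply (ex_RInt_continuous (V := R_CompleteNormedModule)). intros t _. apply f_cont.
    + intros t t_in. apply f_bound. lra.
  - rewrite (is_RInt_unique _ _ _ _ (is_RInt_exp_opp M a b)).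
    specialize (f_bound b a_le_b). lra.
Qed.

Lemma is_lim_0_of_exp_bound (f : R -> R) (a M : R) :
  (forall t, a <= t -> Rabs (f t) <= M * exp (- t)) -> is_lim f p_infty 0.
Proof.
  intros f_bound.
  assert (exp_lim : is_lim (fun t => exp (- t)) p_infty 0).
  { apply (is_lim_comp exp Ropp p_infty 0 m_infty).
    - exact is_lim_exp_m.
    - apply (is_lim_opp (fun t => t) p_infty p_infty), is_lim_id.
    - now exists 0. }
  assert (scaled_lim : forall u, is_lim (fun t => u * exp (- t)) p_infty 0).
  { intros u. replace (Finite 0) with (Rbar_mult u 0) by (simpl; f_equal; ring).
    now apply is_lim_scal_l. }
  apply (is_lim_le_le_loc (fun t => - M * exp (- t)) (fun t => M * exp (- t)));
    [|apply scaled_lim | apply scaled_lim].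
  exists a. intros t a_lt_t.
  specialize (f_bound t ltac:(lra)). apply Rabs_le_between in f_bound. lra.
Qed.

Lemma is_derive_of_quadratic_remainder (f : R -> R) (x l M delta : R) :
  0 < delta ->
  (forall h, Rabs h <= delta -> Rabs (f (x + h) - f x - h * l) <= h ^ 2 * M) ->
  is_derive f x l.
Proof.
  intros delta_pos remainder. apply is_derive_Reals. intros eps eps_pos.
  assert (M_pos : 0 < Rabs M + 1) by (assert (M_nonneg := Rabs_pos M); lra).
  assert (radius_pos : 0 < Rmin delta (eps / (Rabs M + 1))).
  { apply Rmin_pos; [exact delta_pos | now apply Rdiv_lt_0_compat]. }
  exists (mkposreal _ radius_pos). intros h h_neq h_lt. simpl in h_lt.
  assert (h_lt_delta := Rlt_le_trans _ _ _ h_lt (Rmin_l _ _)).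
  assert (h_lt_eps := Rlt_le_trans _ _ _ h_lt (Rmin_r _ _)).
  apply (Rlt_div_r _ _ _ M_pos) in h_lt_eps.
  assert (h_pos : 0 < Rabs h) by now apply Rabs_pos_lt.
  replace ((f (x + h) - f x) / h - l) with ((f (x + h) - f x - h * l) / h)
    by (field; exact h_neq).
  rewrite Rabs_div by exact h_neq. apply Rlt_div_l; [exact h_pos|].
  specialize (remainder h ltac:(lra)). rewrite <- pow2_abs in remainder.
  assert (M_le := Rle_abs M). nra.
Qed.

Lemma is_derive_RInt_ray (F : R -> R -> R) (dF G J : R -> R) (a x l M delta : R) :
  0 < delta ->
  (forall h, Rabs h <= delta -> is_RInt_ray (F (x + h)) a (J (x + h))) ->
  is_RInt_ray dF a l -> is_RInt_ray G a M ->
  (forall h t, Rabs h <= delta -> a <= t ->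
     Rabs (F (x + h) t - F x t - h * dF t) <= h ^ 2 * G t) ->
  is_derive J x l.
Proof.
  intros delta_pos J_int dF_int G_int remainder.
  apply (is_derive_of_quadratic_remainder J x l M delta delta_pos). intros h h_le.
  assert (J_x := J_int 0 ltac:(rewrite Rabs_R0; lra)). rewrite Rplus_0_r in J_x.
  assert (diff := is_RInt_ray_lin _ _ a 1 (- h) _ _
    (is_RInt_ray_lin _ _ a 1 (-1) _ _ (J_int h h_le) J_x) dF_int).
  replace (J (x + h) - J x - h * l) with (1 * (1 * J (x + h) + -1 * J x) + - h * l) by ring.
  refine (is_RInt_ray_le _ (fun t => h ^ 2 * G t) a _ _ _ diff
    (is_RInt_gen_scal G (h ^ 2) M G_int)).
  intros t a_le_t. cbv beta.
  replace (1 * (1 * F (x + h) t + -1 * F x t) + - h * dF t)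
    with (F (x + h) t - F x t - h * dF t) by ring.
  now apply remainder.
Qed.

(** * The function K_nu *)

Definition integrandK (mu x t : R) : R := exp (- x * cosh t) * cosh (mu * t).

Lemma cosh_ge_1 (t : R) : 1 <= cosh t.
Proof.
  unfold cosh. assert (at_t := exp_ineq1_le t). assert (at_opp := exp_ineq1_le (- t)). lra.
Qed.

Lemma cosh_ge_sqr (t : R) : 0 <= t -> t ^ 2 / 8 <= cosh t.
Proof.
  intros t_nonneg. unfold cosh. assert (opp_pos := exp_pos (- t)).
  assert (exp_t : exp t = exp (t / 2) * exp (t / 2)) by (rewrite <- exp_plus; f_equal; field).
  assert (half := exp_ineq1_le (t / 2)). nra.
Qed.

Lemma exp_le_exp_Rabs_mul (mu t : R) : 0 <= t -> exp (mu * t) <= exp (Rabs mu * t).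
Proof. intros t_nonneg. apply exp_le, Rmult_le_compat_r; [exact t_nonneg | apply Rle_abs]. Qed.

Lemma exp_opp_le_exp_Rabs_mul (mu t : R) : 0 <= t -> exp (- (mu * t)) <= exp (Rabs mu * t).
Proof.
  intros t_nonneg. rewrite Ropp_mult_distr_l, <- Rabs_Ropp. now apply exp_le_exp_Rabs_mul.
Qed.

Lemma cosh_le_exp_Rabs (mu t : R) : 0 <= t -> cosh (mu * t) <= exp (Rabs mu * t).
Proof.
  intros t_nonneg. assert (pos := exp_le_exp_Rabs_mul mu t t_nonneg).
  assert (neg := exp_opp_le_exp_Rabs_mul mu t t_nonneg). unfold cosh. lra.
Qed.

Lemma Rabs_sinh_le_exp_Rabs (mu t : R) : 0 <= t -> Rabs (sinh (mu * t)) <= exp (Rabs mu * t).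
Proof.
  intros t_nonneg. assert (pos := exp_le_exp_Rabs_mul mu t t_nonneg).
  assert (neg := exp_opp_le_exp_Rabs_mul mu t t_nonneg).
  assert (exp_t_pos := exp_pos (mu * t)). assert (exp_opp_pos := exp_pos (- (mu * t))).
  unfold sinh. apply Rabs_le. lra.
Qed.

(* Completing the square in [t] after [t ^ 2 / 8 <= cosh t]. *)
Lemma exp_cosh_decay (a x t : R) :
  0 < x -> 0 <= t ->
  exp (- x * cosh t) * exp (a * t) <= exp (2 * (a + 1) ^ 2 / x) * exp (- t).
Proof.
  intros x_pos t_nonneg. rewrite <- !exp_plus. apply exp_le.
  assert (cosh_ge := cosh_ge_sqr t t_nonneg).
  assert (square : 2 * (a + 1) ^ 2 / x - (a + 1) * t + x * (t ^ 2 / 8)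
                   = (4 * (a + 1) - x * t) ^ 2 / (8 * x)) by (field; lra).
  assert (square_nonneg : 0 <= (4 * (a + 1) - x * t) ^ 2 / (8 * x)).
  { apply Rmult_le_pos; [apply pow2_ge_0 | left; apply Rinv_0_lt_compat; lra]. }
  nra.
Qed.

Lemma integrandK_pos (mu x t : R) : 0 < integrandK mu x t.
Proof.
  apply Rmult_lt_0_compat; [apply exp_pos|]. assert (cosh_ge := cosh_ge_1 (mu * t)). lra.
Qed.

Lemma integrandK_continuous (mu x t : R) : continuous (integrandK mu x) t.
Proof. apply (ex_derive_continuous (integrandK mu x)). unfold integrandK. now auto_derive. Qed.

Lemma BesselK_correct (mu x : R) :
  0 < x ->
  is_RInt_ray (integrandK mu x) 0 (BesselK mu x) /\
  forall b, 0 <= b -> RInt (integrandK mu x) 0 b <= BesselK mu x.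
Proof.
  intros x_pos.
  destruct (ex_RInt_ray_exp_bound (integrandK mu x) 0 (exp (2 * (Rabs mu + 1) ^ 2 / x)))
    as [l [l_int l_ge]].
  - apply integrandK_continuous.
  - intros t t_nonneg. split; [left; apply integrandK_pos|].
    eapply Rle_trans; [|now apply exp_cosh_decay].
    apply Rmult_le_compat_l; [left; apply exp_pos | now apply cosh_le_exp_Rabs].
  - assert (value : BesselK mu x = l) by exact (is_RInt_gen_unique _ _ l_int).
    now rewrite value.
Qed.

Lemma BesselK_pos (mu x : R) : 0 < x -> 0 < BesselK mu x.
Proof.
  intros x_pos. eapply Rlt_le_trans; [|apply (proj2 (BesselK_correct mu x x_pos) 1); lra].
  apply RInt_gt_0; [lra | intros; apply integrandK_pos | intros; apply integrandK_continuous].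
Qed.

Lemma cosh_plus_add_cosh_minus (a b : R) : cosh (a + b) + cosh (a - b) = 2 * (cosh a * cosh b).
Proof.
  unfold cosh, Rminus. rewrite !Ropp_plus_distr, Ropp_involutive, !exp_plus. field.
Qed.

Lemma cosh_plus_sub_cosh_minus (a b : R) : cosh (a + b) - cosh (a - b) = 2 * (sinh a * sinh b).
Proof.
  unfold cosh, sinh, Rminus. rewrite !Ropp_plus_distr, Ropp_involutive, !exp_plus. field.
Qed.

Lemma cosh_mul_integrandK (mu x t : R) :
  cosh t * integrandK mu x t
  = 1 / 2 * integrandK (mu + 1) x t + 1 / 2 * integrandK (mu - 1) x t.
Proof.
  unfold integrandK. rewrite Rmult_plus_distr_r, Rmult_minus_distr_r, !Rmult_1_l.
  assert (sum := cosh_plus_add_cosh_minus (mu * t) t). nra.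
Qed.

Lemma exp_cosh_mul_sinh_mul_sinh (mu x t : R) :
  exp (- x * cosh t) * (sinh (mu * t) * sinh t)
  = 1 / 2 * integrandK (mu + 1) x t + - (1 / 2) * integrandK (mu - 1) x t.
Proof.
  unfold integrandK. rewrite Rmult_plus_distr_r, Rmult_minus_distr_r, !Rmult_1_l.
  assert (diff := cosh_plus_sub_cosh_minus (mu * t) t). nra.
Qed.

(* Integrates the derivative of [exp (- x cosh t) sinh (mu t)], which vanishes at both
   ends of the ray. *)
Lemma BesselK_rec (mu x : R) :
  0 < x -> BesselK (mu + 1) x = BesselK (mu - 1) x + 2 * mu / x * BesselK mu x.
Proof.
  intros x_pos.
  set (G := fun t => exp (- x * cosh t) * sinh (mu * t)).
  set (g := fun t => mu * integrandK mu x t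
    + - x * (1 / 2 * integrandK (mu + 1) x t + - (1 / 2) * integrandK (mu - 1) x t)).
  assert (G_derive : forall t, is_derive G t (g t)).
  { intros t. unfold g. rewrite <- exp_cosh_mul_sinh_mul_sinh.
    unfold G, integrandK. auto_derive; [easy | ring]. }
  assert (g_cont : forall t, continuous g t).
  { intros t. apply (ex_derive_continuous g). unfold g, integrandK. now auto_derive. }
  assert (G_lim : is_lim G p_infty 0).
  { apply (is_lim_0_of_exp_bound G 0 (exp (2 * (Rabs mu + 1) ^ 2 / x))). intros t t_nonneg.
    unfold G. rewrite Rabs_mult, (Rabs_pos_eq (exp _)) by (left; apply exp_pos).
    eapply Rle_trans; [|now apply exp_cosh_decay].
    apply Rmult_le_compat_l; [left; apply exp_pos | now apply Rabs_sinh_le_exp_Rabs]. }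
  assert (by_parts := is_RInt_ray_derive G g 0 0 G_derive g_cont G_lim).
  assert (by_orders := is_RInt_ray_lin _ _ 0 mu (- x) _ _ (proj1 (BesselK_correct mu x x_pos))
    (is_RInt_ray_lin _ _ 0 (1 / 2) (- (1 / 2)) _ _
       (proj1 (BesselK_correct (mu + 1) x x_pos)) (proj1 (BesselK_correct (mu - 1) x x_pos)))).
  apply (is_RInt_gen_unique (V := R_CompleteNormedModule)) in by_parts, by_orders.
  assert (G_0 : G 0 = 0) by (unfold G; rewrite Rmult_0_r, sinh_0; ring).
  unfold g in by_parts. rewrite by_parts, G_0 in by_orders.
  apply (Rmult_eq_reg_l x); [|lra].
  replace (x * (BesselK (mu - 1) x + 2 * mu / x * BesselK mu x))
    with (x * BesselK (mu - 1) x + 2 * mu * BesselK mu x) by (field; lra).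
  lra.
Qed.

Lemma exp_remainder_le (u : R) : Rabs (exp u - 1 - u) <= u ^ 2 * exp (Rabs u).
Proof.
  assert (tangent := exp_ineq1_le u). rewrite Rabs_pos_eq by lra.
  assert (chord := exp_tangent_le 0 u). rewrite exp_0 in chord.
  destruct (Rle_lt_dec 0 u) as [u_nonneg | u_neg].
  - rewrite (Rabs_pos_eq u) by exact u_nonneg. nra.
  - assert (exp_ge_1 : 1 <= exp (Rabs u)) by (rewrite <- exp_0; apply exp_le, Rabs_pos).
    nra.
Qed.

Lemma integrandK_remainder_le (mu x h t : R) :
  Rabs h <= x / 2 ->
  Rabs (integrandK mu (x + h) t - integrandK mu x t - h * - (cosh t * integrandK mu x t))
  <= h ^ 2 * (cosh t * (cosh t * integrandK mu (x / 2) t)).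
Proof.
  intros h_le. unfold integrandK.
  assert (c_ge := cosh_ge_1 t). assert (m_ge := cosh_ge_1 (mu * t)).
  set (c := cosh t) in *. set (m := cosh (mu * t)) in *.
  assert (E_pos := exp_pos (- x * c)). set (E := exp (- x * c)) in *.
  assert (factor : exp (- (x + h) * c) = E * exp (- h * c))
    by (unfold E; rewrite <- exp_plus; f_equal; ring).
  assert (damping : E * exp (Rabs (- h * c)) <= exp (- (x / 2) * c)).
  { unfold E. rewrite <- exp_plus. apply exp_le.
    rewrite Rabs_mult, Rabs_Ropp, (Rabs_pos_eq c) by lra. nra. }
  rewrite factor.
  replace (E * exp (- h * c) * m - E * m - h * - (c * (E * m)))
    with (E * m * (exp (- h * c) - 1 - - h * c)) by ring.
  rewrite Rabs_mult, (Rabs_pos_eq (E * m)) by nra.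
  apply Rle_trans with (E * m * ((- h * c) ^ 2 * exp (Rabs (- h * c)))).
  - apply Rmult_le_compat_l; [nra | apply exp_remainder_le].
  - replace (E * m * ((- h * c) ^ 2 * exp (Rabs (- h * c))))
      with ((h * c) ^ 2 * m * (E * exp (Rabs (- h * c)))) by ring.
    replace (h ^ 2 * (c * (c * (exp (- (x / 2) * c) * m))))
      with ((h * c) ^ 2 * m * exp (- (x / 2) * c)) by ring.
    apply Rmult_le_compat_l; [|exact damping].
    apply Rmult_le_pos; [apply pow2_ge_0 | lra].
Qed.

Lemma is_RInt_cosh_mul_integrandK (mu x : R) :
  0 < x ->
  is_RInt_ray (fun t => cosh t * integrandK mu x t) 0
    (1 / 2 * BesselK (mu + 1) x + 1 / 2 * BesselK (mu - 1) x).
Proof.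
  intros x_pos.
  eapply is_RInt_ray_ext; [intros t; symmetry; apply cosh_mul_integrandK|].
  apply is_RInt_ray_lin; now apply BesselK_correct.
Qed.

Lemma ex_RInt_cosh_sqr_mul_integrandK (mu x : R) :
  0 < x -> exists M : R, is_RInt_ray (fun t => cosh t * (cosh t * integrandK mu x t)) 0 M.
Proof.
  intros x_pos. eexists.
  apply (is_RInt_ray_ext (fun t => 1 / 2 * (cosh t * integrandK (mu + 1) x t)
                                   + 1 / 2 * (cosh t * integrandK (mu - 1) x t))).
  - intros t. rewrite (cosh_mul_integrandK mu). ring.
  - apply is_RInt_ray_lin; now apply is_RInt_cosh_mul_integrandK.
Qed.

Lemma is_derive_BesselK (mu x : R) :
  0 < x ->
  is_derive (BesselK mu) x (- (1 / 2 * BesselK (mu + 1) x + 1 / 2 * BesselK (mu - 1) x)).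
Proof.
  intros x_pos.
  destruct (ex_RInt_cosh_sqr_mul_integrandK mu (x / 2)) as [M remainder_int]; [lra|].
  apply (is_derive_RInt_ray (integrandK mu) (fun t => - (cosh t * integrandK mu x t))
           (fun t => cosh t * (cosh t * integrandK mu (x / 2) t)) _ 0 x _ M (x / 2)).
  - lra.
  - intros h h_le. apply Rabs_le_between in h_le. apply BesselK_correct. lra.
  - now apply (is_RInt_gen_opp (V := R_NormedModule)), is_RInt_cosh_mul_integrandK.
  - exact remainder_int.
  - intros h t h_le _. now apply integrandK_remainder_le.
Qed.

Lemma is_derive_BesselK_succ (nu x : R) :
  0 < x -> is_derive (BesselK nu) x (- BesselK (nu + 1) x + nu / x * BesselK nu x).
Proof.
  intros x_pos. evar_last; [now apply is_derive_BesselK|].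
  rewrite (BesselK_rec nu x x_pos). field. lra.
Qed.

Lemma is_derive_BesselK_pred (nu x : R) :
  0 < x -> is_derive (BesselK nu) x (- BesselK (nu - 1) x - nu / x * BesselK nu x).
Proof.
  intros x_pos. evar_last; [now apply is_derive_BesselK|].
  rewrite (BesselK_rec nu x x_pos). field. lra.
Qed.

Definition log_derivative_K (nu : R) : R -> R :=
  log_derivative (- nu) (BesselK nu) (fun x => - BesselK (nu + 1) x).

Lemma riccati_solution_K (nu : R) :
  riccati_solution (fun x => x ^ 2 + nu ^ 2) (log_derivative_K nu).
Proof.
  replace (nu ^ 2) with ((- nu) ^ 2) by ring.
  apply riccati_solution_log_derivative; intros x x_pos.
  - now apply BesselK_pos.
  - evar_last; [now apply is_derive_BesselK_succ|]. field. lra.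
  - evar_last; [now apply (is_derive_opp (BesselK (nu + 1))), is_derive_BesselK_pred|].
    replace (nu + 1 - 1) with nu by ring. unfold opp; simpl. field. lra.
Qed.

Lemma riccati_bound_minus_lt_log_derivative_K (nu x : R) :
  1 / 2 <= nu -> 0 < x -> riccati_bound (-1) nu x < log_derivative_K nu x.
Proof.
  intros nu_ge. apply (riccati_supersolution_lt (fun x => x ^ 2 + nu ^ 2)).
  - apply riccati_solution_K.
  - now apply riccati_bound_minus_supersolution.
  - intros t _. left. apply riccati_bound_minus_neg. lra.
Qed.

Theorem theorem6 (x nu : R) (hx : 0 < x) (hnu : 1 / 2 <= nu) :
  x * (BesselI (nu - 1) x / BesselI nu x) >
    nu - 1 / 2 * (1 + nu ^ 2 / (nu ^ 2 + x ^ 2))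
    + sqrt (x ^ 2 + (nu / sqrt (nu ^ 2 + x ^ 2)
                     + sqrt (nu ^ 2 - x ^ 4 / (4 * (x ^ 2 + nu ^ 2) ^ 2))) ^ 2)
  /\
  x * (BesselK (nu + 1) x / BesselK nu x) <
    nu + 1 / 2 * (1 + nu ^ 2 / (nu ^ 2 + x ^ 2))
    + sqrt (x ^ 2 + (- (nu / sqrt (nu ^ 2 + x ^ 2))
                     + sqrt (nu ^ 2 - x ^ 4 / (4 * (x ^ 2 + nu ^ 2) ^ 2))) ^ 2).
Proof.
  assert (I_gt := riccati_bound_plus_lt_log_derivative_I nu x hnu hx).
  assert (K_lt := riccati_bound_minus_lt_log_derivative_K nu x hnu hx).
  unfold log_derivative_I, log_derivative_K, log_derivative, riccati_bound, radical,
    shifted_order, shrunk_order, cosine, cos2 in I_gt, K_lt.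
  split.
  - rewrite !Rmult_1_l in I_gt. lra.
  - rewrite Rdiv_opp_l in K_lt.
    replace (-1 * (nu / sqrt (nu ^ 2 + x ^ 2))) with (- (nu / sqrt (nu ^ 2 + x ^ 2)))
      in K_lt by ring.
    lra.
Qed.
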